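(* The metric space $(\mathcal{W},d_\Box)$ is compact.
   Context: $\mathcal{W}$ is the set of all Lebesgue measurable functions $f:[0,1]\to[0,1]$, identified when equal almost everywhere. The interval-metric is $d_\Box(f,g)=\|f-g\|_\Box$, where for $h:[0,1]\to[-1,1]$ measurable $\|h\|_\Box=\sup_{I\subseteq[0,1]}\left|\int_Ih(x)\,dx\right|$, the supremum being over all intervals $I\subseteq[0,1]$. *)

(* Defs.v *)
From HB Require Import structures.
From mathcomp Require Import all_boot all_order all_algebra.
From mathcomp Require Import all_classical all_reals all_analysis.
From mathcomp Require Import measurable_realfun.
From mathcomp Require Import ring lra.
Set Implicit Arguments.
Unset Strict Implicit.
Unset Printing Implicit Defensive.
Import Order.TTheory GRing.Theory Num.Theory.
Import numFieldNormedType.Exports.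
Local Open Scope classical_set_scope.
Local Open Scope ring_scope.
Local Open Scope quotient_scope.

(* The real line with the sigma-algebra of all Lebesgue (not just Borel)
   measurable sets, i.e. the domain of [completed_lebesgue_measure]. *)
Definition lebesgueType (R : realType) : measurableType _ :=
  caratheodory_type ((@wlength R idfun)^*)%mu.

Definition lambda (R : realType) : {measure set (lebesgueType R) -> \bar R} :=
  @completed_lebesgue_measure R.

(* A function on [0, 1] is represented by a total function whose values outside
   [0, 1] are irrelevant: the quotient [W] below forgets them. *)
Record unit_fun (R : realType) := UnitFun {
  unit_fun_val :> R -> R ;
  unit_fun_measurable :
    measurable_fun (`[0, 1]%classic : set (lebesgueType R)) unit_fun_val ;
  unit_fun_itv : forall x : R, 0 <= x <= 1 -> 0 <= unit_fun_val x <= 1 }.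

HB.instance Definition _ (R : realType) := gen_eqMixin (unit_fun R).
HB.instance Definition _ (R : realType) := gen_choiceMixin (unit_fun R).

Definition unit_fun_ae_eq (R : realType) (f g : unit_fun R) : bool :=
  `[< (f : R -> R) = g %[ae lambda R in `[0, 1]%classic] >].

(* [I] ranges over open, half-open and closed intervals; the empty one only
   contributes 0. The supremum is that of a bounded set for the differences of
   two [unit_fun]s (see [interval_norm_le]). *)
Definition interval_norm (R : realType) (h : R -> R) : R :=
  sup [set `| \int[lambda R]_(x in [set` I]) h x |
      | I in [set I : interval R | [set` I] `<=` `[0, 1]]].

Section W_metric.
Context {R : realType}.
Implicit Types (f g h : unit_fun R) (I : interval R).
Local Notation mu := (lambda R).
Local Notation I01 := (`[0, 1]%classic : set (lebesgueType R)).

#[global] Instance lambda_ae_filter : Filter (nbhs (almost_everywhere mu)).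
Proof. exact: ae_filter_ringOfSetsType. Qed.

Lemma borel_lebesgue (A : set R) :
  measurable A -> measurable (A : set (lebesgueType R)).
Proof. exact: sub_caratheodory. Qed.

Lemma lambda_borel (A : set R) : mu A = lebesgue_measure A.
Proof. by []. Qed.

Lemma lebesgue_measurable_itv I : measurable ([set` I] : set (lebesgueType R)).
Proof. by apply: borel_lebesgue; exact: measurable_itv. Qed.

Lemma lambda01 : mu `[0, 1]%classic = 1%E.
Proof.
rewrite lambda_borel.
by rewrite lebesgue_measure_itv/= lte_fin ltr01 -EFinB subr0.
Qed.

Lemma sub_unit_fun_integrable f g :
  mu.-integrable I01 (EFin \o (fun x => f x - g x)).
Proof.
apply: measurable_bounded_integrable.
- exact: lebesgue_measurable_itv.
- by rewrite [ltLHS]lambda01 ltry.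
- by apply: measurable_funB; exact: unit_fun_measurable.
- exists 1; split => // x x1 y /=; rewrite in_itv/= => y01.
  rewrite (le_trans _ (ltW x1))//.
  have /andP[? ?] := unit_fun_itv f y01.
  have /andP[? ?] := unit_fun_itv g y01.
  by rewrite ler_norml; apply/andP; split; rewrite ?lerBlDr ?lerBrDr; lra.
Qed.

Lemma integral_itv0_ae0 (h : R -> R) : mu.-integrable I01 (EFin \o h) ->
  (forall I, [set` I] `<=` `[0, 1] ->
     (\int[mu]_(x in [set` I]) (h x)%:E = 0)%E) ->
  h = cst 0 %[ae mu in `[0, 1]%classic].
Proof.
move=> ih h0.
have mI01 : measurable I01 by exact: lebesgue_measurable_itv.
have sub_int (A : set (lebesgueType R)) : measurable A -> A `<=` I01 ->
    mu.-integrable A (EFin \o h).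
  by move=> mA AI; exact: (integrableS mI01).
have borel0 (S : set R) : measurable S ->
    (\int[mu]_(x in (S `&` I01 : set (lebesgueType R))) (h x)%:E = 0)%E.
  apply: (@dynkin_induction _ R (@ocitv R) (fun S =>
    \int[mu]_(x in (S `&` I01 : set (lebesgueType R))) (h x)%:E = 0)%E) => //=.
  - exact: ocitvI.
  - by rewrite setTI; exact: h0.
  - move=> _ [a _ <-].
    rewrite -(set_itvI `]a.1, a.2] `[0, 1]); apply: h0.
    by rewrite set_itvI; exact: subIsetr.
  - move=> {}S mS S0.
    have mSI : measurable (S `&` I01 : set (lebesgueType R)).
      by apply: measurableI => //; exact: borel_lebesgue.
    have mCSI : measurable (~` S `&` I01 : set (lebesgueType R)).
      by apply: measurableI => //; apply: borel_lebesgue; exact: measurableC.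
    have : (\int[mu]_(x in I01) (h x)%:E = 0)%E by exact: h0.
    rewrite -[X in integral _ X _](setTI I01) -(setUv S) setIUl.
    rewrite integral_setU//.
    + by rewrite [X in (X + _)%E]S0 add0e.
    + rewrite -setIUl setUv setTI.
      exact: (measurable_int _ ih).
    + apply/disj_setPRL => x [Sx _] [? _] //.
  - move=> F mF tF F0; rewrite setI_bigcupl integral_bigcup.
    + by apply: eseries0 => i _ _; exact: F0.
    + by apply: trivIset_setIr.
    + by move=> k; apply: measurableI => //; exact: borel_lebesgue.
    + apply: sub_int; last by move=> x [k _ []].
      apply: bigcupT_measurable => k; apply: measurableI => //.
      exact: borel_lebesgue.
suff : ae_eq mu I01 (EFin \o h) (cst 0%E).
  by apply: filterS => x /= + xI => /(_ xI)[].
apply: integral_ae_eq => // E EI mE; rewrite integral0.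
have : (completed_algebra_gen (@lebesgue_measure R)) E.
  by rewrite -g_sigma_completed_algebra_genE completed_caratheodory_measurable.
move=> [A mA [N [M [mM M0 NM]] ANE]].
have mM' := borel_lebesgue mM; have mA' := borel_lebesgue mA.
rewrite (negligible_integral mM' mE)//; last exact: sub_int.
have -> : E `\` M = A `\` M.
  rewrite -ANE; apply/seteqP; split => x [].
    by case=> // /NM.
  by move=> Ax nMx; split => //; left.
have AI : A `<=` I01 by move=> x Ax; apply: EI; rewrite -ANE; left.
rewrite -(negligible_integral mM' mA')//; last exact: sub_int.
by have := borel0 _ mA; rewrite setIidl.
Qed.

Definition interval_dist f g : R := interval_norm (fun x => f x - g x).

Lemma interval_norm_le f g I : [set` I] `<=` `[0, 1] ->
  `| \int[mu]_(x in [set` I]) (f x - g x) | <= interval_dist f g.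
Proof.
move=> I01I; apply: ub_le_sup; last by exists I.
have mI01 : measurable I01 by exact: lebesgue_measurable_itv.
exists (\int[mu]_(x in I01) `|f x - g x|) => _ [J J01 <-].
have mJ := lebesgue_measurable_itv J.
have iI := sub_unit_fun_integrable f g.
have iJ := integrableS mI01 mJ J01 iI.
apply: (le_trans (le_normr_Rintegral mJ iJ)).
have aiI := integrable_norm iI.
have aiJ := integrable_norm iJ.
rewrite /Rintegral fine_le//; [exact: integrable_fin_num..|].
apply: ge0_subset_integral => //=.
exact: (measurable_int _ aiI).
Qed.

Lemma interval_dist_le f g (c : R) :
  (forall I, [set` I] `<=` `[0, 1] ->
     `| \int[mu]_(x in [set` I]) (f x - g x) | <= c) ->
  interval_dist f g <= c.
Proof.
move=> fgc; apply: ge_sup; last by move=> _ [I I01I <-]; exact: fgc.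
by exists `| \int[mu]_(x in [set` `[0, 1]]) (f x - g x) |, `[0, 1].
Qed.

Lemma eq_interval_dist f1 f2 g1 g2 :
  unit_fun_ae_eq f1 f2 -> unit_fun_ae_eq g1 g2 ->
  interval_dist f1 g1 = interval_dist f2 g2.
Proof.
move=> /asboolP f12 /asboolP g12; rewrite /interval_dist /interval_norm.
congr sup; apply: eq_imagel => I /= I01I; congr `| _ |.
have mI := lebesgue_measurable_itv I.
have mI01 : measurable I01 by exact: lebesgue_measurable_itv.
have mfg f g := measurable_int _ (integrableS mI01 mI I01I
  (sub_unit_fun_integrable f g)).
congr fine; apply: ae_eq_integral => //; [exact: mfg..|].
move: f12 g12; apply: filterS2 => x f12x g12x /I01I xI /=.
by rewrite f12x// g12x.
Qed.

Lemma unit_fun_ae_eqxx : reflexive (@unit_fun_ae_eq R).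
Proof. by move=> f; apply/asboolP; exact: aeW. Qed.

Lemma unit_fun_ae_eqC : symmetric (@unit_fun_ae_eq R).
Proof.
by move=> f g; apply/asboolP/asboolP; apply: filterS => x /[apply] ->.
Qed.

Lemma unit_fun_ae_eq_trans : transitive (@unit_fun_ae_eq R).
Proof.
move=> g f h /asboolP fg /asboolP gh; apply/asboolP.
by move: fg gh; apply: filterS2 => x + + xI => /(_ xI) -> /(_ xI).
Qed.

Canonical unit_fun_ae_equiv := EquivRel (@unit_fun_ae_eq R)
  unit_fun_ae_eqxx unit_fun_ae_eqC unit_fun_ae_eq_trans.

Definition W : Type := {eq_quot @unit_fun_ae_eq R}.
HB.instance Definition _ := Choice.on W.
HB.instance Definition _ := EqQuotient.on W.

(* The choice of representatives is immaterial, see [W_dist_pi]. *)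
Definition W_dist (u v : W) : R := interval_dist (repr u) (repr v).

Lemma W_dist_pi f g : W_dist (\pi f) (\pi g) = interval_dist f g.
Proof. by apply: eq_interval_dist; rewrite -eqmodE reprK. Qed.

Let W_distxx u : W_dist u u = 0.
Proof.
apply/eqP; rewrite eq_le; apply/andP; split.
  apply: interval_dist_le => I _.
  under eq_Rintegral do rewrite subrr.
  by rewrite /Rintegral integral0 normr0.
have := @interval_norm_le (repr u) (repr u) `[0, 1] (@subset_refl _ _).
exact: le_trans.
Qed.

Let W_dist_eq0 u v : W_dist u v = 0 -> u = v.
Proof.
move=> uv0; rewrite -[u]reprK -[v]reprK; apply/eqP; rewrite eqmodE.
apply/asboolP.
have mI01 : measurable I01 by exact: lebesgue_measurable_itv.
have iI := sub_unit_fun_integrable (repr u) (repr v).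
have := integral_itv0_ae0 iI; set P := (X in (X -> _) -> _).
have : P.
  move=> I I01I.
  have iJ := integrableS mI01 (lebesgue_measurable_itv I) I01I iI.
  have := @interval_norm_le (repr u) (repr v) I I01I.
  rewrite -/(W_dist u v) uv0 normr_le0 /Rintegral => /eqP.
  move=> I0; rewrite -(fineK (integrable_fin_num _ iJ)) ?I0//.
  exact: lebesgue_measurable_itv.
move=> /[swap] /[apply]; apply: filterS => x /= /[apply] /eqP.
by rewrite subr_eq0 => /eqP.
Qed.

Let W_distC u v : W_dist u v = W_dist v u.
Proof.
wlog suff : u v / W_dist u v <= W_dist v u.
  by move=> h; apply/eqP; rewrite eq_le !h.
apply: interval_dist_le => I I01I.
have mI01 : measurable I01 by exact: lebesgue_measurable_itv.
apply: le_trans (interval_norm_le _ _ I01I).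
rewrite -normrN -mulN1r -RintegralZl.
- by rewrite le_eqVlt; apply/orP; left; apply/eqP; congr `| _ |;
    apply: eq_Rintegral => x _; rewrite mulN1r opprB.
- exact: lebesgue_measurable_itv.
- apply: (integrableS mI01) (sub_unit_fun_integrable _ _) => //.
  exact: lebesgue_measurable_itv.
Qed.

Let W_dist_triangle v u w : W_dist u w <= W_dist u v + W_dist v w.
Proof.
apply: interval_dist_le => I I01I.
have mI01 : measurable I01 by exact: lebesgue_measurable_itv.
have mI := lebesgue_measurable_itv I.
have -> : \int[mu]_(x in [set` I]) (repr u x - repr w x) =
    \int[mu]_(x in [set` I]) (repr u x - repr v x) +
    \int[mu]_(x in [set` I]) (repr v x - repr w x).
  rewrite -RintegralD//.
  - by apply: eq_Rintegral => x _; rewrite addrA subrK.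
  - exact: (integrableS mI01 mI I01I (sub_unit_fun_integrable _ _)).
  - exact: (integrableS mI01 mI I01I (sub_unit_fun_integrable _ _)).
by apply: (le_trans (ler_normD _ _)); apply: lerD; exact: interval_norm_le.
Qed.

HB.instance Definition _ := isMetric.Build R W
  W_distxx W_dist_eq0 W_distC W_dist_triangle.

Lemma mdist_W f g : mdist (\pi f : W) (\pi g : W) = interval_dist f g.
Proof. exact: W_dist_pi. Qed.

End W_metric.
Arguments W : clear implicits.

(* Main.v *)
Require Import Defs.
From HB Require Import structures.
From mathcomp Require Import all_boot all_order all_algebra.
From mathcomp Require Import all_classical all_reals all_analysis.
From mathcomp Require Import measurable_realfun lra.
Set Implicit Arguments.
Unset Strict Implicit.
Unset Printing Implicit Defensive.
Import Order.TTheory GRing.Theory Num.Theory.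
Import numFieldNormedType.Exports.
Local Open Scope classical_set_scope.
Local Open Scope ring_scope.
Local Open Scope quotient_scope.

(** Compactness is proved with ultrafilters. Encode a function f in W by its
    primitive x |-> \int_0^x f. Primitives of functions with values in [0, 1]
    have all their slopes in [0, 1] (predicate [slope01]): they are
    nondecreasing and 1-Lipschitz. Let U be an ultrafilter on W.

    - For each x the values of the primitives at x stay in the compact interval
      [0, 1], so they converge along U to some F x, and slopes in [0, 1] survive
      this pointwise limit ([ultra_cvg_primitive]).
    - F is, up to a constant, the primitive of an element g of W
      ([slope01_primitive]). Indeed the Stieltjes measure of F is bounded by the
      Lebesgue measure because it is so on intervals, and the Radon-Nikodym
      density of a measure nu <= mu can be chosen with values in [0, 1]
      ([density_le1]).
    - Since all the functions involved are 1-Lipschitz, closeness on a finite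
      grid of [0, 1] implies uniform closeness ([slope01_grid]), so pointwise
      convergence of the primitives along U is uniform. An integral over an
      interval is a difference of two values of the primitive, hence uniform
      closeness of primitives is closeness in the interval metric
      ([interval_dist_le_primitive]), and U converges to g. *)

(** * Ultrafilters and compactness *)

(** Ultrafilters decide every set, so a cluster point is already a limit. *)
Lemma ultra_cvg_compact (T : Type) (V : topologicalType) (U : set_system T)
    (A : set V) (h : T -> V) : UltraFilter U -> compact A ->
  (forall t, A (h t)) -> exists l : V, h @ U --> l.
Proof.
move=> UU cA hA.
have UA : (h @ U) A by apply: (@filterE _ U) => t; exact: hA.
have [l [_ hl]] := cA (h @ U) _ UA.
exists l => N Nl; have [//|UnN] := in_ultra_setVsetC (h @^-1` N) UU.
by have [v [nNv /nNv]] := hl (~` N) N UnN Nl.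
Qed.

(** * Functions with slopes in [0, 1] *)

Section grid.
Context {R : realType}.
Implicit Types F G : R -> R.

Definition slope01 F := forall a b, a <= b -> 0 <= F b - F a <= b - a.

Lemma slope01_continuous F : slope01 F -> continuous F.
Proof.
move=> F1 x; apply/cvgrPdist_le => e e0; near=> t.
apply: (@le_trans _ _ `|x - t|).
  have [xt|/ltW tx] := leP x t.
    have /andP[? ?] := F1 _ _ xt.
    by rewrite (distrC (F x)) (distrC x) !ger0_norm// subr_ge0.
  by have := F1 _ _ tx => /andP[? ?]; rewrite !ger0_norm// subr_ge0.
near: t; apply: cvgr_dist_le => //; exact: cvg_id.
Unshelve. all: by end_near. Qed.

(** A point x lies within 1 / n.+1 to the right of a grid point y, and both F
    and G grow by a quantity in [0, 1 / n.+1] from y to x: the error c at y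
    increases by at most 1 / n.+1, and not twice as much. *)
Lemma slope01_grid F G (n : nat) (c : R) : slope01 F -> slope01 G ->
  (forall k : 'I_n.+2, `|F (k%:R / n.+1%:R) - G (k%:R / n.+1%:R)| <= c) ->
  forall x, 0 <= x <= 1 -> `|F x - G x| <= c + n.+1%:R^-1.
Proof.
move=> F1 G1 FG x /andP[x0 x1].
have n0 : 0 < n.+1%:R :> R by rewrite ltr0n.
have [y [yx xy]] : exists y, [/\ y <= x, x - y <= n.+1%:R^-1 &
    `|F y - G y| <= c].
  have /truncn_itv/andP[] : 0 <= x * n.+1%:R by rewrite mulr_ge0.
  set k := Num.truncn _ => kx xk.
  have kn : (k < n.+2)%N.
    by rewrite ltnS -(ler_nat R) (le_trans kx)// ler_piMl// ler0n.
  exists (k%:R / n.+1%:R); split; last exact: FG (Ordinal kn).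
    by rewrite ler_pdivrMr.
  rewrite lerBlDr -[X in _ <= X + _]mul1r -mulrDl ler_pdivlMr//.
  by rewrite addrC natr1 ltW.
move: (n.+1%:R^-1) xy => d xy.
have /andP[? ?] := F1 _ _ yx; have /andP[? ?] := G1 _ _ yx.
by rewrite !ler_norml => /andP[? ?]; apply/andP; split; lra.
Qed.

End grid.

(** * Measures dominated by another one with constant 1 *)

Section bounded_density.
Context d (T : measurableType d) (R : realType).
Variables (mu : {sigma_finite_measure set T -> \bar R})
          (nu : {finite_measure set T -> \bar R}).
Local Open Scope ereal_scope.

(** Let f be the Radon-Nikodym density. Where 1 < f, the bound nu <= mu goes
    against nu = \int f >= mu, so truncating f at 1 does not change its
    integrals. *)
Lemma density_le1 : (forall A, measurable A -> nu A <= mu A) ->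
  exists g : T -> R, [/\ measurable_fun setT g, (forall x, 0 <= g x <= 1)%R &
    forall A, measurable A -> nu A = \int[mu]_(x in A) (g x)%:E].
Proof.
move=> numu.
have dom : nu `<< mu.
  apply/null_content_dominatesP => A mA muA0; apply/eqP.
  by rewrite eq_le measure_ge0 andbT -muA0 numu.
have [f [f0 ffin fi fE]] := radon_nikodym_sigma_finite dom.
have mf : measurable_fun setT f := measurable_int _ fi.
have mff : measurable_fun setT (fine \o f) by exact: measurableT_comp.
have mg : measurable_fun setT (fun x => Num.min (fine (f x)) 1)%R.
  by apply: measurable_minr.
exists (fun x => Num.min (fine (f x)) 1)%R; split => //.
  by move=> x; rewrite le_min ler01 fine_ge0//= ge_min lexx orbT.
move=> A mA.
pose B := [set x | f x <= 1].
have mB : measurable B by rewrite -[B]setTI; exact: emeasurable_fun_infty_c.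
have g0 x : 0 <= (Num.min (fine (f x)) 1)%:E.
  by rewrite lee_fin le_min ler01 fine_ge0.
have mgE : measurable_fun setT (fun x => (Num.min (fine (f x)) 1)%:E).
  exact/measurable_EFinP.
have mAB : measurable (A `&` B) by exact: measurableI.
have mAnB : measurable (A `&` ~` B).
  by apply: measurableI => //; exact: measurableC.
rewrite fE// -(setIT A) -(setUv B) setIUr !ge0_integral_setU//=; last 4 first.
- exact: measurable_funTS.
- by apply/disj_setPRL => x [_ nB] [].
- exact: measurable_funTS.
- by apply/disj_setPRL => x [_ nB] [].
(* The integrals agree pointwise on [B]; on its complement both equal the
   mu-measure of the domain. *)
congr (_ + _).
  apply: eq_integral => x /set_mem [_ fx1].
  by rewrite min_l ?fineK// -lee_fin fineK.
rewrite -fE//.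
transitivity (\int[mu]_(x in A `&` ~` B) (cst 1 x)); last first.
  apply: eq_integral => x /set_mem [_ /= /negP]; rewrite -ltNge => fx1.
  by rewrite min_r// -lee_fin fineK// ltW.
apply/eqP; rewrite eq_le integral_cst// mul1e numu//= -[leLHS]mul1e.
rewrite -[X in X * _]/(1%R%:E) -integral_cst// fE// ge0_le_integral//.
- exact: measurable_funTS.
- by move=> x [_ /= /negP]; rewrite -ltNge => /ltW.
Qed.

End bounded_density.

Section stieltjes.
Context {R : realType}.
Local Open Scope ereal_scope.

(** Both measures are infima over the same countable covers by half-open
    intervals, which are compared termwise. *)
Lemma lebesgue_stieltjes_measure_le (F : cumulative R R) (A : set R) :
  (forall a b, a <= b -> F b - F a <= b - a)%R ->
  lebesgue_stieltjes_measure F A <= lebesgue_measure A.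
Proof.
move=> F1; apply: le_ereal_inf_tmp => _ [B [mB AB] <-].
apply: (@le_trans _ _ (\sum_(k <oo) wlength F (B k))).
  by apply: ereal_inf_lbound; exists B.
apply: lee_nneseries => k _; first by move=> _; exact: wlength_ge0.
have [[a b] _ <-] := mB k; have [ab|ba] := leP a b.
  rewrite [leLHS](wlength_itv_bnd F false false ab).
  rewrite [leRHS](wlength_itv_bnd idfun false false ab).
  by rewrite lee_fin F1.
have -> : `]a, b]%classic = set0 :> set R.
  by rewrite set_itv_ge// bnd_simp -leNgt ltW.
rewrite [leLHS](wlength0 F).
by rewrite [leRHS](wlength0 idfun).
Qed.

Lemma lebesgue_stieltjes_measure_oc (F : cumulative R R) (a b : R) :
  (a <= b)%R -> lebesgue_stieltjes_measure F `]a, b]%classic = (F b - F a)%:E.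
Proof.
move=> ab; rewrite /lebesgue_stieltjes_measure /measure_extension.
by rewrite measurable_mu_extE/= ?wlength_itv_bnd//; exact: is_ocitv.
Qed.

(** On Borel functions the completed measure gives the same integrals as the
    Borel one, its pushforward along the identity; this moves densities found
    by Radon-Nikodym on the Borel sets to the Lebesgue-measurable setting. *)
Lemma ge0_integral_lambda (A : set R) (f : R -> \bar R) :
  measurable A -> measurable_fun A f -> (forall x, 0 <= f x) ->
  \int[lambda R]_(x in A) f x = \int[lebesgue_measure]_(x in A) f x.
Proof.
move=> mA mf f0.
have mid : measurable_fun setT (idfun : lebesgueType R -> measurableTypeR R).
  by move=> _ B mB; rewrite setTI; exact: borel_lebesgue.
by rewrite -(@ge0_integral_pushforward _ _ (lebesgueType R) (measurableTypeR R)
  R idfun mid (lambda R) A f).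
Qed.

End stieltjes.

(** * Primitives of functions with values in [0, 1] *)

Section primitive.
Context {R : realType}.
Implicit Types (f g : unit_fun R) (F : R -> R).
Local Notation mu := (lambda R).
Local Notation I01 := (`[0, 1]%classic : set (lebesgueType R)).

Lemma unit_fun_integrable f (A : set (lebesgueType R)) :
  measurable A -> A `<=` I01 -> mu.-integrable A (EFin \o f).
Proof.
move=> mA AI; have mI : measurable I01 by exact: lebesgue_measurable_itv.
apply: (integrableS mI) => //; apply: measurable_bounded_integrable => //.
- by rewrite [ltLHS]lambda01 ltry.
- exact: unit_fun_measurable.
- exists 1; split => // x x1 y /=; rewrite in_itv/= => y01.
  have /andP[? ?] := unit_fun_itv f y01.
  by rewrite ger0_norm// (le_trans _ (ltW x1)).
Qed.

Lemma lambda_fin (A : set (lebesgueType R)) :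
  measurable A -> A `<=` I01 -> mu A \is a fin_num.
Proof.
move=> mA AI; rewrite ge0_fin_numE ?measure_ge0//.
apply: le_lt_trans (ltry 1); rewrite -[leRHS]lambda01.
by apply: le_measure; rewrite ?inE//; exact: lebesgue_measurable_itv.
Qed.

Lemma unit_fun_Rintegral_bounds f (A : set (lebesgueType R)) :
  measurable A -> A `<=` I01 ->
  0 <= \int[mu]_(x in A) f x <= fine (mu A).
Proof.
move=> mA AI.
have f01 x : A x -> 0 <= f x <= 1.
  by move=> /AI /=; rewrite in_itv/= => /unit_fun_itv.
apply/andP; split.
  by apply: Rintegral_ge0 => x /f01 /andP[].
have -> : fine (mu A) = \int[mu]_(x in A) 1.
  by rewrite Rintegral_cst// mul1r.
apply: le_Rintegral => //; first exact: unit_fun_integrable.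
  apply: measurable_bounded_integrable => //.
    by rewrite -ge0_fin_numE ?measure_ge0// lambda_fin.
  by exists 1; split => // M M1 y _; rewrite normr1 ltW.
by move=> x /f01 /andP[].
Qed.

(** Defined on the whole line, constant on either side of [0, 1], so that the
    limits of primitives are cumulative functions, as Stieltjes measures
    require. *)
Definition primitive f (x : R) : R :=
  \int[mu]_(t in (`[0, 1] `&` `]-oo, x] : set (lebesgueType R))) f t.

Let mcut (I J : interval R) :
  measurable ([set` I] `&` [set` J] : set (lebesgueType R)).
Proof. by apply: measurableI; exact: lebesgue_measurable_itv. Qed.

Lemma primitiveB f (a b : R) : a <= b ->
  primitive f b - primitive f a =
  \int[mu]_(t in (`[0, 1] `&` `]a, b] : set (lebesgueType R))) f t.
Proof.
move=> ab.
pose A : set (lebesgueType R) := `[0, 1] `&` `]-oo, a].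
pose B : set (lebesgueType R) := `[0, 1] `&` `]a, b].
have AB : (`[0, 1] `&` `]-oo, b] : set (lebesgueType R)) = A `|` B.
  by rewrite /A /B -setIUr -itv_bndbnd_setU.
have dAB : [disjoint A & B].
  apply/disj_setPRL => x [_ /=]; rewrite in_itv/= => /andP[ax _] [_ /=].
  by rewrite in_itv/= leNgt ax.
have iAB : mu.-integrable (A `|` B) (EFin \o f).
  apply: unit_fun_integrable; first by apply: measurableU; exact: mcut.
  by rewrite -setIUr; exact: subIsetl.
rewrite /primitive AB (Rintegral_setU (mcut _ _) (mcut _ _) iAB dAB).
by rewrite addrAC subrr add0r.
Qed.

Lemma primitive_bounds f (x : R) : primitive f x \in `[0, 1].
Proof.
have /andP[p0 p1] := unit_fun_Rintegral_bounds f (mcut `[0, 1] `]-oo, x])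
  (@subIsetl _ _ _).
rewrite in_itv/= p0/= (le_trans p1)// -lee_fin fineK ?lambda_fin//.
rewrite -lambda01; apply: le_measure; rewrite ?inE//.
exact: lebesgue_measurable_itv.
Qed.

Lemma primitive_slope01 f : slope01 (primitive f).
Proof.
move=> a b ab; rewrite primitiveB//.
have /andP[-> p1] := unit_fun_Rintegral_bounds f (mcut `[0, 1] `]a, b])
  (@subIsetl _ _ _).
rewrite (le_trans p1)// -lee_fin fineK ?lambda_fin//.
have -> : (b - a)%:E = mu `]a, b]%classic.
  rewrite lambda_borel lebesgue_measure_itv/= lte_fin EFinB.
  by case: ltgtP ab => // -> _; rewrite subee.
by apply: le_measure; rewrite ?inE//; exact: lebesgue_measurable_itv.
Qed.

Let oc_sub01 (a b : R) : 0 <= a -> b <= 1 ->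
  (`]a, b] `<=` `[0, 1])%classic.
Proof.
move=> a0 b1 x /=; rewrite !in_itv/= => /andP[/ltW ax xb].
by rewrite (le_trans a0)// (le_trans xb).
Qed.

(** An interval I in [0, 1] with infimum a and supremum b differs from ]a, b]
    only at a and b, which form a null set. *)
Lemma interval_dist_le_oc f g (c : R) :
  (forall a b, 0 <= a -> a <= b -> b <= 1 ->
    `| \int[mu]_(x in `]a, b]) (f x - g x) | <= c) ->
  interval_dist f g <= c.
Proof.
move=> H; apply: interval_dist_le => I I01I.
have [I0|/set0P [z Iz]] := eqVneq [set` I] set0.
  have := H 0 0 (lexx _) (lexx _) ler01.
  by rewrite I0 set_itv_ge ?bnd_simp// ltxx.
have lI : lbound [set` I] 0 by move=> x /I01I /=; rewrite in_itv/= => /andP[].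
have uI : ubound [set` I] 1 by move=> x /I01I /=; rewrite in_itv/= => /andP[].
have hlI : has_lbound [set` I] by exists 0.
have huI : has_ubound [set` I] by exists 1.
set a := inf [set` I]; set b := sup [set` I].
have a0 : 0 <= a by apply: lb_le_inf => //; exists z.
have b1 : b <= 1 by apply: ge_sup => //; exists z.
have ab : a <= b.
  by apply: (@le_trans _ _ z); [exact: ge_inf|exact: ub_le_sup].
have mN : measurable ([set a; b] : set (lebesgueType R)).
  by apply: borel_lebesgue; apply: measurableU; exact: measurable_set1.
have muN : mu [set a; b] = 0%E.
  by rewrite lambda_borel; apply: countable_lebesgue_measure0;
    exact: finite_set_countable.
have mI (J : interval R) : measurable ([set` J] : set (lebesgueType R)).
  exact: lebesgue_measurable_itv.
have iI (J : interval R) : [set` J] `<=` `[0, 1] ->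
    mu.-integrable [set` J] (EFin \o (fun x => f x - g x)).
  move=> JI; apply: (integrableS (mI `[0, 1])) => //.
  exact: sub_unit_fun_integrable.
have oc01 : `]a, b] `<=` `[0, 1] by exact: oc_sub01.
have := H a b a0 ab b1; rewrite /Rintegral.
rewrite (negligible_integral mN (mI _) (iI _ oc01) muN).
rewrite (negligible_integral mN (mI _) (iI _ I01I) muN).
suff -> : [set` I] `\` [set a; b] = `]a, b] `\` [set a; b] by [].
apply/seteqP; split => x [+ /not_orP [/eqP xa /eqP xb]].
  move=> Ix; split; last by case; exact/eqP.
  by rewrite /= in_itv/= lt_neqAle eq_sym xa ge_inf//= ub_le_sup.
rewrite /= in_itv/= => /andP[ax xb']; split; last by case; exact/eqP.
have xbs : x < b by rewrite lt_neqAle xb.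
have [u Iu ux] := inf_lt (ex_intro _ z Iz) ax.
have [v Iv xv] := sup_gt (ex_intro _ z Iz) xbs.
by apply: (interval_is_interval Iu Iv); rewrite (ltW ux) (ltW xv).
Qed.

(** The density of the Stieltjes measure of F is a derivative of F. The measure
    is restricted to [0, 1] to make it finite. *)
Lemma slope01_primitive F : slope01 F ->
  exists g, forall a b, 0 <= a -> a <= b -> b <= 1 ->
    primitive g b - primitive g a = F b - F a.
Proof.
move=> F1.
have ndF : nondecreasing F.
  by move=> a b /F1 /andP[+ _]; rewrite subr_ge0.
have rcF := right_continuousW (slope01_continuous F1).
pose cF := isCumulative.Build R _ R F ndF rcF.
pose G : cumulative R R := HB.pack F cF.
have G1 a b : a <= b -> G b - G a <= b - a by move=> /F1 /andP[].
have leF := fun A => @lebesgue_stieltjes_measure_le R G A G1.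
have mI : measurable (`[0, 1]%classic : set (measurableTypeR R)).
  exact: measurable_itv.
have finI : (lebesgue_stieltjes_measure G `[0%R, 1%R]%classic < +oo)%E.
  apply: le_lt_trans (leF _) _.
  by rewrite lebesgue_measure_itv/= lte_fin ltr01 -EFinB ltry.
pose nu := mfrestr mI finI.
have [|g [mg g01 gE]] := @density_le1 _ _ R (@lebesgue_measure R) nu.
  move=> A mA; apply: (le_trans _ (leF A)).
  by apply: le_measure; rewrite ?inE//; exact: measurableI.
have mg' : measurable_fun I01 g.
  apply: measurable_funTS => _ B mB; rewrite setTI; apply: borel_lebesgue.
  by rewrite -[X in measurable X]setTI; exact: mg.
exists (UnitFun mg' (fun x _ => g01 x)) => a b a0 ab b1.
have oc01 : (`]a, b] `<=` `[0, 1])%classic by exact: oc_sub01.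
rewrite primitiveB//= setIidr//.
rewrite /Rintegral ge0_integral_lambda.
- rewrite -gE; last exact: measurable_itv.
  transitivity
    (fine (lebesgue_stieltjes_measure G (`]a, b] `&` `[0, 1]))) => //.
  by rewrite setIidl// lebesgue_stieltjes_measure_oc.
- exact: measurable_itv.
- by apply/measurable_EFinP; exact: measurable_funTS.
- by move=> x; rewrite lee_fin; have /andP[] := g01 x.
Qed.

(** The triangle inequality at the two endpoints of an interval doubles the
    constant. *)
Lemma interval_dist_le_primitive f g F (c : R) :
  (forall a b, 0 <= a -> a <= b -> b <= 1 ->
    primitive g b - primitive g a = F b - F a) ->
  (forall x, 0 <= x <= 1 -> `|primitive f x - F x| <= c) ->
  interval_dist g f <= c + c.
Proof.
move=> gF fF; apply: interval_dist_le_oc => a b a0 ab b1.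
have mab : measurable (`]a, b]%classic : set (lebesgueType R)).
  exact: lebesgue_measurable_itv.
have oc01 : (`]a, b] `<=` `[0, 1])%classic by exact: oc_sub01.
rewrite RintegralB//; [|exact: unit_fun_integrable..].
have incr (h : unit_fun R) :
  \int[mu]_(x in `]a, b]) h x = primitive h b - primitive h a.
  by rewrite primitiveB// setIidr.
have /fF : 0 <= a <= 1 by rewrite a0 (le_trans ab).
have /fF : 0 <= b <= 1 by rewrite b1 (le_trans a0).
rewrite !incr gF// !ler_norml => /andP[? ?] /andP[? ?].
by apply/andP; split; lra.
Qed.

End primitive.

(** * Convergence of ultrafilters *)

Lemma ultra_cvg_primitive (R : realType) (U : set_system (W R)) :
  UltraFilter U ->
  exists2 F : R -> R, slope01 F &
    forall x, primitive (repr u) x @[u --> U] --> F x.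
Proof.
move=> UU.
have /choice[F FE] x : exists l : R, primitive (repr u) x @[u --> U] --> l.
  apply: (ultra_cvg_compact (h := fun u => primitive (repr u) x) UU
    (@segment_compact R 0 1)) => u.
  exact: primitive_bounds.
exists F => // a b ab.
have FB : (primitive (repr u) b - primitive (repr u) a) @[u --> U] -->
  F b - F a by exact: cvgB.
have inc (u : W R) : 0 <= primitive (repr u) b - primitive (repr u) a <= b - a.
  exact: primitive_slope01.
apply/andP; split.
  by apply: (cvgr_to_ge FB); apply: nearW => u; have /andP[] := inc u.
by apply: (cvgr_to_le FB); apply: nearW => u; have /andP[] := inc u.
Qed.

Theorem theorem17 (R : realType) : compact [set: W R].
Proof.
rewrite compact_ultra => U UU _.
have [F F1 FE] := ultra_cvg_primitive UU.
have [g gF] := slope01_primitive F1.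
exists (\pi g); split => //; apply/fcvg_ballP => e e0.
have e4 : 0 < e / 4 by rewrite divr_gt0.
have [n ne] : exists n, n.+1%:R^-1 < e / 4.
  have [n _ ne] := near_infty_natSinv_lt (PosNum e4).
  by exists n; exact: (ne n (leqnn n)).
(* A distance below e is reached with error e / 8 on a grid of step less than
   e / 4: the uniform error e / 8 + e / 4 is doubled for intervals. *)
have : \forall u \near U, forall k : 'I_n.+2,
    `|primitive (repr u) (k%:R / n.+1%:R) - F (k%:R / n.+1%:R)| <= e / 8.
  apply: filter_forall => k.
  have /cvgrPdist_le/(_ _ _) H := FE (k%:R / n.+1%:R).
  have e8 : 0 < e / 8 by rewrite divr_gt0.
  by move: (H _ e8); apply: filterS => u; rewrite distrC.
apply: filterS => u uF.
rewrite ballEmdist /= -[u]reprK mdist_W.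
have fF := slope01_grid (primitive_slope01 (repr u)) F1 uF.
apply: le_lt_trans (interval_dist_le_primitive gF fF) _.
by move: (n.+1%:R^-1) ne => d de; lra.
Qed.
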